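(* Let $P\subset\mathbb{R}^3$ be a simple (3-dimensional, convex) polytope. If the boundary $\mathrm{bd}\,P$ is orthogonally connected, then $P$ is rich and the graph $\mathcal{G}_P$ is connected.
   Context: Fix the standard coordinate axes ($x$-, $y$-, $z$-axis) in $\mathbb{R}^3$. A polygonal path in $\mathbb{R}^3$ is orthogonal if each of its edges (line-segments) is parallel to one of the coordinate axes. A set $S\subset\mathbb{R}^3$ is orthogonally connected if any two distinct points of $S$ are joined by an orthogonal path contained in $S$. A polytope is the convex hull of finitely many points; its faces are its 2-dimensional faces (facets) and its edges are its 1-dimensional faces. A polytope in $\mathbb{R}^3$ is simple if every vertex belongs to exactly 3 faces. Marks: every face and every edge $F$ of $P$ gets the mark $x$ (respectively $y$, $z$) if its affine hull is parallel to the $x$-axis (respectively $y$-axis, $z$-axis); $m(F)\subset\{x,y,z\}$ denotes the set of marks of $F$. So an edge has 0 or 1 marks and a face has 0, 1 or 2 marks. $P$ is called rich if every face of $P$ has a non-empty set of marks and at least one face has a set of marks of cardinality 2. $\mathcal{G}_P$ is the graph whose vertices are the faces of $P$, two faces $F,F'$ being adjacent in $\mathcal{G}_P$ if they have a common edge $E$ of $P$ whose set of marks is different from those of the two faces, i.e. $m(E)\neq m(F)$ and $m(E)\neq m(F')$. *)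

(* Defs.v *)
From Stdlib Require Import Relation_Operators.
From mathcomp Require Import all_boot all_order all_algebra.
From mathcomp Require Import all_classical all_reals all_analysis.
Import Order.TTheory GRing.Theory Num.Theory numFieldNormedType.Exports.

Set Implicit Arguments.
Unset Strict Implicit.
Unset Printing Implicit Defensive.

Local Open Scope classical_set_scope.
Local Open Scope ring_scope.

Section Polytopes.
Variable R : realType.
Notation V := 'rV[R]_3.
Implicit Types (P S A F E : set V) (x y v : V).

Definition dot (a x : V) : R := \sum_i a 0 i * x 0 i.

Definition convex_hull S : set V := smallest (fun A => convex_set A) S.

Definition affine_set A :=
  forall x y, A x -> A y -> forall t : R, A ((1 - t) *: x + t *: y).

Definition affine_hull S : set V := smallest affine_set S.

(* False for every [k] when [S] is empty. *)
Definition affine_dim S (k : nat) :=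
  exists x (U : {vspace V}),
    affine_hull S = [set y | y - x \in U] /\ \dim U = k.

Definition polytope P := exists2 S, finite_set S & P = convex_hull S.

(* [a = 0] is harmless: it only yields [P] itself or the empty set. *)
Definition face P (k : nat) F :=
  (exists (a : V) (b : R),
     (forall x, P x -> dot a x <= b) /\ F = [set x | P x /\ dot a x = b])
  /\ affine_dim F k.

Definition vertex P v := face P 0%N [set v].
Definition edge P E := face P 1%N E.
Definition facet P F := face P 2%N F.

Definition simple_polytope P :=
  polytope P /\
  forall v, vertex P v -> ([set F | facet P F /\ F v] #= `I_3)%card.

Definition boundary S : set V := closure S `\` S^°.

(* The axes x, y, z are indexed by 0, 1, 2 in ['I_3]. *)
Definition axis (i : 'I_3) : V := delta_mx 0 i.

Definition segment x y : set V :=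
  [set (1 - t) *: x + t *: y | t in `[0, 1]].

Definition orthogonal_edge x y :=
  x <> y /\ exists (i : 'I_3) (t : R), y - x = t *: axis i.

(* [s] lists the successive vertices of the path after its origin [x]. *)
Definition orthogonal_path_in S x (s : seq V) :=
  path (fun p q => `[< orthogonal_edge p q /\ segment p q `<=` S >]) x s.

Definition orthogonally_connected S :=
  forall x y, S x -> S y -> x <> y ->
    exists2 s : seq V, orthogonal_path_in S x s & last x s = y.

(* A flat containing a parallel of the axis counts as parallel to it. *)
Definition parallel_to_axis A (i : 'I_3) :=
  forall x, A x -> forall t : R, A (x + t *: axis i).

Definition marks F : {set 'I_3} :=
  [set i | `[< parallel_to_axis (affine_hull F) i >]]%SET.

Definition rich P :=
  (forall F, facet P F -> marks F != finset.set0) /\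
  (exists2 F, facet P F & #|marks F| = 2%N).

Definition face_adj P F F' :=
  [/\ facet P F, facet P F', F <> F' &
      exists E, [/\ edge P E, E `<=` F, E `<=` F',
                    marks E != marks F & marks E != marks F']].

(* [face_adj P] is symmetric, so this is undirected connectedness. *)
Definition face_graph_connected P :=
  forall F F', facet P F -> facet P F' ->
    clos_refl_trans (set V) (face_adj P) F F'.

End Polytopes.

(* Main.v *)
Require Import Defs.
From HB Require Import structures.
From Stdlib Require Import Relation_Operators.
From mathcomp Require Import all_boot all_order all_algebra.
From mathcomp Require Import all_classical all_reals all_analysis.
From mathcomp Require Import zify ring lra.
Import Order.TTheory GRing.Theory Num.Theory numFieldNormedType.Exports.

Set Implicit Arguments.
Unset Strict Implicit.
Unset Printing Implicit Defensive.

Local Open Scope classical_set_scope.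
Local Open Scope ring_scope.

(** The boundary of a polytope [P] is the union of finitely many facets, so a
    segment in it that is parallel to an axis lies in a facet marked by this
    axis ([axis_segment_facet]).  Each facet has a point that lies in no other
    facet ([facet_private_point]); a path leaving such a point shows that the
    facet has a mark.

    The vertices of an orthogonal path are followed by facets.  Simplicity
    enters only through [facets_meet_edge]: two facets with a common point share
    an edge, whose marks are exactly their common marks, and there is at most
    one of those.  Hence two such facets [F1], [F2] are adjacent in the face
    graph unless their sets of marks are nested ([facets_adj]).  If
    [marks F1] is a proper subset of [marks F2], it is a singleton [{i}], the
    common edge is parallel to the axis [i], and from inside this edge a path
    can turn only into [F2].  If the two sets are the same singleton [{i}], the
    facets are still linked in the graph: the common edge is parallel to the
    axis [i], and at its end there is a facet that is not, hence is adjacent to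
    both ([parallel_strips_linked]).  So among the facets containing a path
    segment one keeps those with the most marks, its owners; owners of two
    consecutive segments are linked ([owners_linked]), and a path between private points of
    two facets links these facets.

    A facet with two marks exists by counting.  If each facet had a single mark,
    a path could change direction only where it crosses into the facet of the
    next segment, at the unique point where its line meets the plane of that
    facet.  The turning points reachable from a given point would then form a
    countable set, and the lines through them parallel to the mark of a facet
    could not cover a transversal segment in this facet ([one_mark_absurd]).

    The polyhedral geometry rests on [exit_facet]: a direction in which [P] is
    left at once from a point [v] of [P] points outwards across a facet through
    [v].  It follows from the lemma of Farkas, whose halfspace is tilted until
    its boundary contains three affinely independent generators of [P]. *)

(** * Linear algebra in dimension three *)

Section LinearAlgebra.
Variable R : realType.
Notation V := 'rV[R]_3.
Implicit Types (a b c x y : V).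

Lemma dotC a b : dot a b = dot b a.
Proof. by apply: eq_bigr => i _; rewrite mulrC. Qed.

Lemma dotZDr a k x y : dot a (k *: x + y) = k * dot a x + dot a y.
Proof.
rewrite /dot mulr_sumr -big_split; apply: eq_bigr => i _ /=.
by rewrite !mxE; ring.
Qed.

Lemma dotZDl a b k x : dot (k *: a + b) x = k * dot a x + dot b x.
Proof. by rewrite dotC dotZDr !(dotC x). Qed.

Lemma dot0r a : dot a 0 = 0.
Proof. by rewrite /dot big1 // => i _; rewrite mxE mulr0. Qed.

Lemma dotDr a x y : dot a (x + y) = dot a x + dot a y.
Proof. by rewrite -[x]scale1r dotZDr scale1r mul1r. Qed.

Lemma dotZr a k x : dot a (k *: x) = k * dot a x.
Proof. by rewrite -[k *: x]addr0 dotZDr dot0r addr0. Qed.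

Lemma dotNr a x : dot a (- x) = - dot a x.
Proof. by rewrite -scaleN1r dotZr mulN1r. Qed.

Lemma dotBr a x y : dot a (x - y) = dot a x - dot a y.
Proof. by rewrite dotDr dotNr. Qed.

Lemma dotDl a b x : dot (a + b) x = dot a x + dot b x.
Proof. by rewrite dotC dotDr !(dotC x). Qed.

Lemma dotZl k a x : dot (k *: a) x = k * dot a x.
Proof. by rewrite dotC dotZr (dotC x). Qed.

Lemma dotNl a x : dot (- a) x = - dot a x.
Proof. by rewrite dotC dotNr (dotC x). Qed.

Definition dotE := (dotBr, dotDr, dotZr, dotNr, dotDl, dotZl, dotNl).

Lemma dot_gt0 a : a != 0 -> 0 < dot a a.
Proof.
move=> a0; rewrite lt_neqAle eq_sym sumr_ge0 ?andbT => [|i _]; last first.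
  by rewrite -expr2 sqr_ge0.
apply: contra_neq a0 => /eqP; rewrite psumr_eq0 => [|i _]; last first.
  by rewrite -expr2 sqr_ge0.
move=> /allP a0; apply/rowP => i; rewrite mxE.
by have /= := a0 i; rewrite mem_index_enum mulf_eq0 orbb => /(_ isT)/eqP.
Qed.

Lemma dot_axis a i : dot a (axis R i) = a 0 i.
Proof.
rewrite /dot (bigD1 i) //= big1 => [|j /negPf ji]; rewrite mxE eqxx ?eqxx /=.
  by rewrite mulr1 addr0.
by rewrite ji mulr0.
Qed.

Lemma axis_neq0 i : axis R i != 0.
Proof.
apply/eqP => /rowP/(_ i)/eqP; rewrite !mxE !eqxx /=; exact/negP/oner_neq0.
Qed.

Lemma dot_linear a : linear (dot a : V -> R^o).
Proof. by move=> k x y; rewrite dotZDr. Qed.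

HB.instance Definition _ a :=
  GRing.isLinear.Build R V R^o _ (dot a : V -> R^o) (dot_linear a).

(** Planes are compared through these direction spaces, so that the incidences
    of facets reduce to counting dimensions. *)
Definition perp a : {vspace V} := lker (linfun (dot a : V -> R^o)).

Lemma mem_perp a x : (x \in perp a) = (dot a x == 0).
Proof. by rewrite memv_ker lfunE. Qed.

Lemma dim_space : \dim {:V} = 3%N.
Proof. by rewrite dimvf /dim /= mul1n. Qed.

Lemma dim_le3 (U : {vspace V}) : (\dim U <= 3)%N.
Proof. by have := dimvS (subvf U); rewrite dim_space. Qed.

Lemma dim_eq3 (U : {vspace V}) : \dim U = 3%N -> U = fullv.
Proof. by move=> U3; apply/eqP; rewrite eqEdim subvf dim_space U3. Qed.

Lemma dim_perp_ge a : (2 <= \dim (perp a))%N.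
Proof.
have := limg_ker_dim (linfun (dot a : V -> R^o)) fullv.
rewrite capfv dim_space => E.
have : (\dim (linfun (dot a : V -> R^o) @: fullv) <= 1)%N.
  by rewrite (leq_trans (dimvS (subvf _))) // dimvf.
by rewrite -(leq_add2l (\dim (perp a))) E addn1.
Qed.

Lemma dim_perp a : a != 0 -> \dim (perp a) = 2%N.
Proof.
move=> a0; apply/eqP; rewrite eqn_leq dim_perp_ge andbT -ltnS.
rewrite ltn_neqAle dim_le3 andbT; apply/negP => /eqP/dim_eq3 pf.
have : a \in perp a by rewrite pf memvf.
by rewrite mem_perp gt_eqF // dot_gt0.
Qed.

Lemma common_perp a b : exists2 e, e != 0 & dot a e = 0 /\ dot b e = 0.
Proof.
have := dimv_sum_cap (perp a) (perp b).
have := leq_add (dim_perp_ge a) (dim_perp_ge b).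
have := dim_le3 (perp a + perp b).
move=> h1 h2 h3.
have h : (0 < \dim (perp a :&: perp b))%N.
  by rewrite -(leq_add2l (\dim (perp a + perp b))) h3 addn1 (leq_trans _ h2).
exists (vpick (perp a :&: perp b)).
  by rewrite vpick0 -dimv_eq0 -lt0n.
by have := memv_pick (perp a :&: perp b); rewrite memv_cap !mem_perp
  => /andP[/eqP -> /eqP ->].
Qed.

Lemma dim_perp_cap a b : a != 0 -> b != 0 -> perp a != perp b ->
  \dim (perp a :&: perp b) = 1%N.
Proof.
move=> a0 b0 ab; have := dimv_sum_cap (perp a) (perp b).
rewrite !dim_perp //.
suff -> : \dim (perp a + perp b) = 3%N.
  by move=> h; apply: (@addnI 3); rewrite h.
apply/eqP; rewrite eqn_leq dim_le3 ltnNge.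
apply: contra ab => h.
have /eqP -> : perp a == (perp a + perp b)%VS.
  by rewrite eqEdim addvSl dim_perp.
by rewrite eq_sym eqEdim addvSr dim_perp.
Qed.

End LinearAlgebra.

(** * The lemma of Farkas *)

Section Farkas.
Variable R : realFieldType.

(** Induction on the generators.  If the functional [c] found without the
    generator [w] is positive on [w], project all vectors along [w] onto the
    kernel of [c]; a functional for the projected vectors, composed with the
    projection, vanishes on [w].  The cone [C] is not required to be generated by
    [ws]: the same [C] then serves for the projected generators.  The pairing is
    abstract because the lemma is used both in space and in one more
    dimension. *)
Lemma farkas (D W : lmodType R) (br : D -> W -> R) (C : set W)
    (brl : forall k c c' x, br (k *: c + c') x = k * br c x + br c' x)
    (brr : forall k c x y, br c (k *: x + y) = k * br c x + br c y)
    (br_sep : forall x, x != 0 -> exists c, 0 < br c x)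
    (C0 : C 0) (CD : forall x y, C x -> C y -> C (x + y))
    (CZ : forall k x, 0 <= k -> C x -> C (k *: x))
    (ws : seq W) (d : W) :
  (forall w, w \in ws -> C w) -> ~ C d ->
  exists2 c, (forall w, w \in ws -> br c w <= 0) & 0 < br c d.
Proof.
elim: {ws}(size ws) {-2}ws (erefl (size ws)) d => [|n IH] [|w ws] //=.
  move=> _ d _ Cd; have /br_sep[c cd] : d != 0 by apply: contra_not_neq Cd => ->.
  by exists c.
move=> [sz] d wC Cd.
have [c cws cd] : exists2 c, (forall w, w \in ws -> br c w <= 0) & 0 < br c d.
  by apply: IH => // u uws; apply/wC; rewrite inE uws orbT.
have [cw|cw] := leP (br c w) 0.
  by exists c => // u; rewrite inE => /predU1P[->|/cws].
(* The projections of the generators stay in [C] because [c] is nonpositive on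
   them, and that of [d] stays outside because [c] is positive on it. *)
pose pr x := br c w *: x + (- br c x) *: w.
have Cw : C w by apply/wC; rewrite inE eqxx.
have [c' c'ws c'd] : exists2 c',
    (forall u, u \in map pr ws -> br c' u <= 0) & 0 < br c' (pr d).
  apply: IH; first by rewrite size_map.
    move=> _ /mapP[u uws ->]; apply/CD; apply/CZ => //; first exact: ltW.
      by apply/wC; rewrite inE uws orbT.
    by rewrite oppr_ge0 cws.
  move=> Cpr; apply: Cd.
  have -> : d = (br c w)^-1 *: (pr d + br c d *: w).
    by rewrite /pr scaleNr addrNK scalerA mulVf ?scale1r // gt_eqF.
  by apply/CZ; rewrite ?invr_ge0 ?ltW //; apply/CD => //; apply/CZ => //;
    exact: ltW.
have prE x : br (br c w *: c' + (- br c' w) *: c) x = br c' (pr x).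
  have brZ c1 k y : br c1 (k *: y) = k * br c1 y.
    have b0 : br c1 0 = 0.
      by have := brr (-1) c1 0 0; rewrite scaler0 addr0 mulN1r addNr.
    by rewrite -[k *: y]addr0 brr b0 addr0.
  have brZl c1 k y : br (k *: c1) y = k * br c1 y.
    have b0 : br 0 y = 0.
      by have := brl (-1) 0 0 y; rewrite scaler0 addr0 mulN1r addNr.
    by rewrite -[k *: c1]addr0 brl b0 addr0.
  by rewrite /pr brl brr brZ brZl; ring.
exists (br c w *: c' + (- br c' w) *: c); last by rewrite prE.
move=> u; rewrite prE inE => /predU1P[->|uws].
  have -> : pr w = 0 by rewrite /pr scaleNr subrr.
  by have := brr (-1) c' 0 0; rewrite scaler0 addr0 mulN1r addNr => ->.
by apply/c'ws/map_f.
Qed.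

End Farkas.

(** * Convex and affine hulls *)

Section Convexity.
Variable R : realType.
Notation V := 'rV[R]_3.
Implicit Types (A S P F : set V) (a c d e u v x y : V).

Lemma convex_setP A : convex_set (A : set (convex_lmodType V)) <->
  forall x y t, A x -> A y -> 0 <= t -> t <= 1 -> A (t *: x + (1 - t) *: y).
Proof.
split=> [cA x y t Ax Ay t0 t1|cA x y t]; rewrite ?inE => *.
  by have := cA x y (Itv01 t0 t1); rewrite !inE; exact.
exact: cA.
Qed.

Lemma convex_hull_conv S x y t : convex_hull S x -> convex_hull S y ->
  0 <= t -> t <= 1 -> convex_hull S (t *: x + (1 - t) *: y).
Proof.
move=> Sx Sy t0 t1 A [cA SA].
by apply: (proj1 (convex_setP A) cA) => //; [exact: Sx | exact: Sy].
Qed.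

Lemma sub_convex_hull S x : S x -> convex_hull S x.
Proof. by move=> Sx A [_ SA]; exact: SA. Qed.

Lemma convex_hull_min S A :
  (forall x y t, A x -> A y -> 0 <= t -> t <= 1 -> A (t *: x + (1 - t) *: y)) ->
  S `<=` A -> convex_hull S `<=` A.
Proof. by move=> /convex_setP cA SA x; apply; split. Qed.

Lemma convex_hull_le S c b : (forall x, S x -> dot c x <= b) ->
  forall x, convex_hull S x -> dot c x <= b.
Proof.
move=> Sb; apply: convex_hull_min => // x y t xb yb t0 t1.
by rewrite !dotE; nra.
Qed.

(** The points that satisfy the inequality, and are spanned by the generators on
    the plane in case of equality, form a convex set: a proper convex
    combination lies on the plane only if both its ends do. *)
Lemma convex_hull_face S c b : (forall x, S x -> dot c x <= b) ->
  forall x, convex_hull S x -> dot c x = b ->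
    convex_hull [set y | S y /\ dot c y = b] x.
Proof.
move=> Sb; suff H : forall x, convex_hull S x -> dot c x <= b /\
    (dot c x = b -> convex_hull [set y | S y /\ dot c y = b] x) by move=> x /H[].
apply: convex_hull_min => [x y t [xb xB] [yb yB] t0 t1|x Sx]; last first.
  by split=> [|xb]; [exact: Sb | apply: sub_convex_hull].
rewrite !dotE; split=> [|E]; first by nra.
have [t0'|tn0] := eqVneq t 0.
  rewrite t0' scale0r add0r subr0 scale1r; apply: yB; rewrite t0' in E; lra.
have [t1'|tn1] := eqVneq t 1.
  rewrite t1' subrr scale0r addr0 scale1r; apply: xB; rewrite t1' in E; lra.
have {}tn0 : 0 < t by rewrite lt_neqAle eq_sym tn0.
have {}tn1 : t < 1 by rewrite lt_neqAle tn1.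
by apply: convex_hull_conv => //; [apply: xB; nra | apply: yB; nra].
Qed.

Lemma sub_affine_hull S x : S x -> affine_hull S x.
Proof. by move=> Sx A [_ SA]; exact: SA. Qed.

Lemma affine_hull_affine S : affine_set (affine_hull S).
Proof.
move=> x y Sx Sy t A AS; apply: (proj1 AS); [exact: Sx | exact: Sy].
Qed.

Lemma affine_hull_min S A : affine_set A -> S `<=` A -> affine_hull S `<=` A.
Proof. by move=> afA SA x Sx; apply: Sx; split. Qed.

Lemma affine_plane c b : affine_set [set y | dot c y = b].
Proof. by move=> x y /= xb yb t; rewrite !dotE xb yb; ring. Qed.

Lemma affine_hull_plane S c b : (forall x, S x -> dot c x = b) ->
  forall x, affine_hull S x -> dot c x = b.
Proof. by move=> Sb; apply: affine_hull_min => //; exact: affine_plane. Qed.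

Lemma affine_line A x y t : affine_set A -> A x -> A (x + y) -> A (x + t *: y).
Proof.
move=> afA Ax Axy; have := afA _ _ Ax Axy t.
by congr (A _); apply/rowP => i; rewrite !mxE; ring.
Qed.

Lemma affine_plane_span A x y z t k : affine_set A -> A x -> A (x + y) ->
  A (x + z) -> A (x + t *: y + k *: z).
Proof.
move=> afA Ax Axy Axz.
have A1 := affine_line (2 * t) afA Ax Axy.
have A2 := affine_line (2 * k) afA Ax Axz.
have := afA _ _ A1 A2 2^-1; congr (A _).
by apply/rowP => i; rewrite !mxE; field.
Qed.

Lemma affine_dimE S x (U : {vspace V}) k :
  affine_hull S = [set y | y - x \in U] -> \dim U = k -> affine_dim S k.
Proof. by move=> SU Uk; exists x, U. Qed.

End Convexity.

Lemma seq_argmin (R : realDomainType) (T : eqType) (s : seq T) (p : pred T)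
    (f : T -> R) (x : T) : x \in s -> p x ->
  exists y, [/\ y \in s, p y & forall z, z \in s -> p z -> f y <= f z].
Proof.
elim: s x => // w s IH x xs px.
have [/hasP[y ys py]|/hasPn nh] := boolP (has p s).
  have [z [zs pz zmin]] := IH y ys py.
  have [pw|npw] := boolP (p w); last first.
    exists z; split=> [||u]; rewrite ?inE ?zs ?orbT //.
    by move=> /predU1P[->|/zmin//]; rewrite (negPf npw).
  have [wz|zw] := leP (f w) (f z).
    exists w; split; rewrite ?inE ?eqxx // => u /predU1P[->//|us pu].
    exact: le_trans (zmin _ us pu).
  exists z; split; rewrite ?inE ?zs ?orbT // => u /predU1P[-> _|/zmin//].
  exact: ltW.
move: xs; rewrite inE => /predU1P[xw|/nh]; last by rewrite px.
exists w; split; rewrite -?xw ?inE ?eqxx // => u /predU1P[-> //|/nh].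
by move/negPf ->.
Qed.

Lemma card_le3_four (T : Type) (A : set T) (x y z w : T) :
  (A #<= `I_3)%card -> A x -> A y -> A z -> A w ->
  x <> y -> x <> z -> x <> w -> y <> z -> y <> w -> z <> w -> False.
Proof.
move=> /pcard_leP[f] Ax Ay Az Aw xy xz xw yz yw zw.
have flt u : A u -> (f u < 3)%N by move=> Au; exact: (@funS _ _ _ _ f).
have finj u u' : A u -> A u' -> u <> u' -> (f u : nat) <> f u'.
  by move=> Au Au' uu' E; apply: uu'; apply: (@inj _ _ _ f); rewrite ?inE.
move: (finj x y Ax Ay xy) (finj x z Ax Az xz) (finj x w Ax Aw xw).
move: (finj y z Ay Az yz) (finj y w Ay Aw yw) (finj z w Az Aw zw).
move: (flt x Ax) (flt y Ay) (flt z Az) (flt w Aw).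
move: (f x : nat) (f y : nat) (f z : nat) (f w : nat) => p q r t.
lia.
Qed.

Section Polytope.
Variable R : realType.
Notation V := 'rV[R]_3.
Variables (P : set V) (s : seq V).
Hypothesis P_hull : P = convex_hull [set` s].
Hypothesis P_full : affine_dim P 3.
Implicit Types (F : set V) (a c d e u v x y : V) (b : R).

Lemma P_convex x y t : P x -> P y -> 0 <= t -> t <= 1 -> P (t *: x + (1 - t) *: y).
Proof. by rewrite P_hull; exact: convex_hull_conv. Qed.

Lemma P_generator x : x \in s -> P x.
Proof. by move=> xs; rewrite P_hull; exact: sub_convex_hull. Qed.

Lemma P_le c b : (forall x, x \in s -> dot c x <= b) ->
  forall x, P x -> dot c x <= b.
Proof. by rewrite P_hull; exact: convex_hull_le. Qed.

Lemma hull_full : affine_hull P = setT.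
Proof.
have [x [U [-> /dim_eq3 ->]]] := P_full.
by apply/seteqP; split=> y //= _; exact: memvf.
Qed.

Lemma P_flat0 e b : (forall x, P x -> dot e x = b) -> e = 0.
Proof.
move=> /affine_hull_plane; rewrite hull_full => eb.
apply/eqP/negP => /negP/dot_gt0; rewrite eb // -(eb 0) // dot0r ltxx //.
Qed.

Lemma gen_flat0 e b : (forall x, x \in s -> dot e x = b) -> e = 0.
Proof.
move=> eb; apply: (@P_flat0 _ b) => x Px; apply/eqP; rewrite eq_le.
rewrite (P_le (c := e)) // => [|y /eb-> //]; rewrite -lerN2 -dotNl.
by rewrite (P_le (c := - e)) // => y /eb; rewrite dotNl => ->.
Qed.

(** * Directions leaving the polytope *)

(** At a point of [P] these directions form a convex cone, to which the lemma of
    Farkas applies. *)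
Definition feasible v d := exists2 r : R, 0 < r & P (v + r *: d).

Lemma feasible0 v : P v -> feasible v 0.
Proof. by move=> Pv; exists 1 => //; rewrite scaler0 addr0. Qed.

Lemma feasibleD v d e : feasible v d -> feasible v e -> feasible v (d + e).
Proof.
move=> [r r0 Pr] [q q0 Pq]; have rq0 : 0 < r + q by exact: addr_gt0.
exists (r * q / (r + q)); first by rewrite divr_gt0 // mulr_gt0.
have t0 : 0 <= q / (r + q) by rewrite divr_ge0 ?ltW.
have t1 : q / (r + q) <= 1 by rewrite ler_pdivrMr // mul1r lerDr ltW.
have := P_convex Pr Pq t0 t1; congr (P _).
by apply/rowP => i; rewrite !mxE; field; rewrite gt_eqF.
Qed.

Lemma feasibleZ v k d : P v -> 0 <= k -> feasible v d -> feasible v (k *: d).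
Proof.
move=> Pv; rewrite le_eqVlt => /predU1P[<- _|k0 [r r0 Pr]].
  by rewrite scale0r; exact: feasible0.
exists (r / k); first by rewrite divr_gt0.
by rewrite scalerA divfK // gt_eqF.
Qed.

Lemma feasible_le v d r k : P v -> P (v + r *: d) -> 0 <= k -> k <= r ->
  P (v + k *: d).
Proof.
move=> Pv Pr k0 kr; have [r0|r0] := eqVneq r 0.
  by have -> : k = 0 by [lra]; rewrite scale0r addr0.
have {}r0 : 0 < r by rewrite lt_neqAle eq_sym r0; exact: le_trans kr.
have t0 : 0 <= k / r by rewrite divr_ge0 // ltW.
have t1 : k / r <= 1 by rewrite ler_pdivrMr // mul1r.
have := P_convex Pr Pv t0 t1; congr (P _).
by apply/rowP => i; rewrite !mxE; field; rewrite gt_eqF.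
Qed.

Definition supports a b F :=
  [/\ a != 0, forall x, P x -> dot a x <= b & F = [set x | P x /\ dot a x = b]].

Lemma supports_facet a b F v x y : supports a b F -> F v -> F x -> F y ->
  x != v -> y - v \notin <[x - v]>%VS -> facet P F.
Proof.
move=> [a0 Pa FE] Fv Fx Fy xv yv.
have Fb z : F z -> dot a z = b by rewrite FE => -[].
split; first by exists a, b.
apply: (@affine_dimE _ _ v (perp a)); last exact: dim_perp.
apply/seteqP; split=> [z|z /=].
  move=> /(affine_hull_plane Fb) zb /=; rewrite mem_perp dotE zb Fb //.
  by rewrite subrr.
have -> : perp a = (<[x - v]> + <[y - v]>)%VS.
  apply/eqP; rewrite eq_sym eqEdim dim_perp //; apply/andP; split.
    by rewrite subv_add -!memvE !mem_perp !dotE !Fb // subrr eqxx.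
  rewrite dimv_disjoint_sum.
    rewrite !dim_vline !subr_eq0 xv; suff -> : y != v by [].
    by apply: contra yv => /eqP ->; rewrite subrr mem0v.
  apply/eqP; rewrite -subv0; apply/subvP => w; rewrite memv_cap memv0.
  move=> /andP[/vlineP[k ->]] /vlineP[t E].
  have [t0|t0] := eqVneq t 0; first by rewrite E t0 scale0r.
  case/negP: yv; apply/vlineP; exists (t^-1 * k).
  by rewrite -scalerA E scalerA mulVf // scale1r.
move=> /memv_addP[_ /vlineP[k ->]] [_ /vlineP[t ->]] /eqP.
rewrite subr_eq addrC addrA => /eqP ->.
apply: affine_plane_span (@affine_hull_affine _ F) _ _ _; rewrite ?subrKC;
  exact: sub_affine_hull.
Qed.

(** The halfspace of normal [c] is tilted around the generators on its boundary,
    in a direction [e] orthogonal to them or in the opposite one, until it meets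
    a further generator.  As [e] is orthogonal to [d], the product of the normal
    with [d] does not change. *)
Lemma tilt_halfspace c e d v :
    (forall x, x \in s -> dot c (x - v) <= 0) -> 0 < dot c d ->
    e != 0 -> dot d e = 0 ->
    (forall x, x \in s -> dot c (x - v) = 0 -> dot e (x - v) = 0) ->
  exists c', [/\ forall x, x \in s -> dot c' (x - v) <= 0, 0 < dot c' d,
    forall x, x \in s -> dot c (x - v) = 0 -> dot c' (x - v) = 0 &
    exists x, [/\ x \in s, dot c' (x - v) = 0 & dot e (x - v) != 0]].
Proof.
move=> cs cd e0 de te.
wlog [x0 x0s ex0] : e e0 de te / exists2 x0, x0 \in s & 0 < dot e (x0 - v).
  move=> H.
  have [x0 x0s ex0] : exists2 x0, x0 \in s & dot e (x0 - v) != 0.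
    apply: contrapT => h; case/eqP: e0; apply: (@gen_flat0 _ (dot e v)) => x xs.
    apply/eqP; rewrite -subr_eq0 -dotBr; apply/negP => /negP ex.
    by apply: h; exists x.
  have [ex0'|ex0'] := ltP 0 (dot e (x0 - v)); first by apply: H => //; exists x0.
  have [||x xs /(te x xs)||c' [c's c'd tc' [x [xs c'x ex]]]] := H (- e).
  - by rewrite oppr_eq0.
  - by rewrite dotNr de oppr0.
  - by rewrite dotNl => ->; rewrite oppr0.
  - by exists x0 => //; rewrite dotNl oppr_gt0 lt_neqAle ex0.
  exists c'; split=> //; exists x; split=> //.
  by move: ex; rewrite dotNl oppr_eq0.
have [x1 [x1s ex1 x1min]] := @seq_argmin R _ s (fun x => 0 < dot e (x - v))
  (fun x => - dot c (x - v) / dot e (x - v)) x0 x0s ex0.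
(* The first generator met is the one with the smallest ratio. *)
pose r := - dot c (x1 - v) / dot e (x1 - v).
have r0 : 0 <= r by rewrite divr_ge0 ?oppr_ge0 ?cs // ltW.
exists (c + r *: e); split=> [x xs||x xs cx|].
- rewrite dotDl dotZl; have [ex|ex] := ltP 0 (dot e (x - v)); last first.
    by have := cs x xs; nra.
  have := x1min x xs ex; rewrite -/r ler_pdivlMr //; lra.
- by rewrite dotDl dotZl (dotC e) de mulr0 addr0.
- by rewrite dotDl dotZl cx te // mulr0 addr0.
exists x1; split=> //; last by rewrite gt_eqF.
by rewrite dotDl dotZl /r divfK ?subrr // gt_eqF.
Qed.

Lemma supports_gen c v : P v -> (forall x, x \in s -> dot c (x - v) <= 0) ->
  forall x, P x -> dot c x <= dot c v.
Proof.
by move=> Pv cs; apply: P_le => x /cs; rewrite dotBr subr_le0.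
Qed.

(** The lemma of Farkas yields a halfspace containing [P], with [v] on its
    boundary plane and [d] pointing out of it.  Tilting it at most twice brings
    two more generators, not collinear with [v], onto the plane, which then cuts
    out a facet. *)
Lemma exit_facet v d : P v -> ~ feasible v d ->
  exists F a b, [/\ facet P F, supports a b F, F v & 0 < dot a d].
Proof.
move=> Pv vd.
have [c0 c0s c0d] : exists2 c,
    (forall w, w \in [seq x - v | x <- s] -> dot c w <= 0) & 0 < dot c d.
  apply: (farkas (br := @dot R) (C := feasible v)) => //.
  - by move=> *; rewrite dotZDl.
  - by move=> *; rewrite dotZDr.
  - by move=> x /dot_gt0; exists x.
  - exact: feasible0.
  - by move=> x y; exact: feasibleD.
  - by move=> k x; exact: feasibleZ.
  move=> _ /mapP[x xs ->]; exists 1 => //; rewrite scale1r subrKC.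
  exact: P_generator.
have {}c0s x : x \in s -> dot c0 (x - v) <= 0 by move=> xs; exact/c0s/map_f.
have [c1 [c1s c1d [x1 [x1s x1v c1x1]]]] : exists c,
    [/\ forall x, x \in s -> dot c (x - v) <= 0, 0 < dot c d &
    exists x, [/\ x \in s, x != v & dot c (x - v) = 0]].
  have [[x [xs xv cx]]|nx] :=
      pselect (exists x, [/\ x \in s, x != v & dot c0 (x - v) = 0]).
    by exists c0; split=> //; exists x.
  have [e e0 [de _]] := common_perp d d.
  have [|c [cs cd _ [x [xs cx ex]]]] := tilt_halfspace c0s c0d e0 de.
    move=> x xs cx; have [->|xv] := eqVneq x v; first by rewrite subrr dot0r.
    by case: nx; exists x.
  exists c; split=> //; exists x; split=> //.
  by apply: contra_neq ex => ->; rewrite subrr dot0r.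
have [c2 [c2s c2d c2x1 [x2 [x2s x2v c2x2]]]] : exists c,
    [/\ forall x, x \in s -> dot c (x - v) <= 0, 0 < dot c d,
    dot c (x1 - v) = 0 &
    exists x, [/\ x \in s, x - v \notin <[x1 - v]>%VS & dot c (x - v) = 0]].
  have [[x [xs xv cx]]|nx] := pselect
      (exists x, [/\ x \in s, x - v \notin <[x1 - v]>%VS & dot c1 (x - v) = 0]).
    by exists c1; split=> //; exists x.
  have [e e0 [de x1e]] := common_perp d (x1 - v).
  have ve x : x - v \in <[x1 - v]>%VS -> dot e (x - v) = 0.
    by move=> /vlineP[k ->]; rewrite dotZr dotC x1e mulr0.
  have [|c [cs cd c1c [x [xs cx ex]]]] := tilt_halfspace c1s c1d e0 de.
    move=> x xs cx; apply: ve; apply/negP => /negP xv.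
    by case: nx; exists x.
  exists c; split=> //; first exact: c1c.
  by exists x; split=> //; apply: contra_neqN ex => /ve.
have tight x : x \in s -> dot c2 (x - v) = 0 -> P x /\ dot c2 x = dot c2 v.
  move=> xs /eqP; rewrite dotBr subr_eq0 => /eqP; split=> //; exact: P_generator.
pose F := [set x | P x /\ dot c2 x = dot c2 v].
have c2F : supports c2 (dot c2 v) F.
  split=> //; last exact: supports_gen.
  by apply: contraTneq c2d => ->; rewrite dotC dot0r ltxx.
exists F, c2, (dot c2 v); split=> //.
apply: (@supports_facet c2 (dot c2 v) F v x1 x2) => //; exact: tight.
Qed.


(** * Facets and their planes *)

Lemma facet_hull F a b : facet P F -> supports a b F ->
  affine_hull F = [set y | dot a y = b].
Proof.
move=> [_ [x [U [FU U2]]]] [a0 _ FE].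
have Fb z : F z -> dot a z = b by rewrite FE => -[].
have xb : dot a x = b.
  by apply: (affine_hull_plane Fb); rewrite FU /= subrr mem0v.
have UE : U = perp a.
  apply/eqP; rewrite eqEdim dim_perp // U2 leqnn andbT; apply/subvP => u uU.
  have /(affine_hull_plane Fb) : affine_hull F (x + u).
    by rewrite FU /= addrC addKr.
  by rewrite dotDr xb mem_perp => /eqP; rewrite -subr_eq0 addrAC subrr add0r.
rewrite FU UE; apply/seteqP; split=> y /=; rewrite mem_perp dotBr xb subr_eq0.
  by move/eqP.
by move=> ->.
Qed.

Lemma facet_nonempty F : facet P F -> exists x, F x.
Proof.
move=> [_ [x [U [FU _]]]]; apply: contrapT => nF.
have : affine_hull F x by rewrite FU /= subrr mem0v.
apply: (@affine_hull_min _ _ set0) => // y Fy; apply: nF; by exists y.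
Qed.

Lemma facet_supports F : facet P F -> exists a b, supports a b F.
Proof.
move=> FF; have [y Fy] := facet_nonempty FF.
have [[a [b [Pa FE]]] [x [U [FU U2]]]] := FF.
exists a, b; split=> //; apply/eqP => a0.
have b0 : b = 0 by move: Fy; rewrite FE a0 => -[_]; rewrite dotC dot0r.
have FP : F = P.
  rewrite FE; apply/seteqP; split=> [z []//|z Pz]; split=> //.
  by rewrite a0 b0 dotC dot0r.
have : U = fullv; last by move=> UE; move: U2; rewrite UE dim_space.
apply/eqP; rewrite eqEsubv subvf; apply/subvP => u _.
have : affine_hull F (u + x) by rewrite FP hull_full.
by rewrite FU /= addrK.
Qed.

Lemma facet_marks F a b i : facet P F -> supports a b F ->
  (i \in marks F) = (a 0 i == 0).
Proof.
move=> FF aF; rewrite inE; have [x Fx] := facet_nonempty FF.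
have xb : dot a x = b by case: aF Fx => _ _ -> [].
rewrite (facet_hull FF aF); apply/asboolP/eqP => [h|ai y /= yb t].
  have := h x xb 1; rewrite /= scale1r dotDr dot_axis xb => E.
  by apply: (@addrI _ b); rewrite E addr0.
by rewrite dotDr dotZr dot_axis ai mulr0 addr0.
Qed.

Lemma perp_sub_eq a c : a != 0 -> c != 0 -> (perp a <= perp c)%VS ->
  perp a = perp c.
Proof. by move=> a0 c0 ac; apply/eqP; rewrite eqEdim ac !dim_perp. Qed.

Lemma supports_eq F F' a b a' b' v : supports a b F -> supports a' b' F' ->
  F v -> F' v -> perp a = perp a' -> F = F'.
Proof.
move=> [_ _ ->] [_ _ ->] [Pv vb] [_ vb'] aa'; apply/seteqP.
split=> x [Px xb]; split=> //; apply/eqP.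
  have : x - v \in perp a by rewrite mem_perp dotBr xb vb subrr.
  by rewrite aa' mem_perp dotBr vb' subr_eq0.
have : x - v \in perp a' by rewrite mem_perp dotBr xb vb' subrr.
by rewrite -aa' mem_perp dotBr vb subr_eq0.
Qed.

Lemma facet_perp F a b a' b' : facet P F -> supports a b F ->
  supports a' b' F -> perp a = perp a'.
Proof.
move=> FF aF aF'; have [x Fx] := facet_nonempty FF.
have := facet_hull FF aF; rewrite (facet_hull FF aF') => E.
have xb : dot a x = b by case: aF Fx => _ _ -> [].
have xb' : dot a' x = b' by case: aF' Fx => _ _ -> [].
apply: perp_sub_eq; [by case: aF | by case: aF' |].
apply/subvP => u; rewrite !mem_perp => /eqP ua.
have : [set y | dot a y = b] (x + u) by rewrite /= dotDr ua addr0.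
by rewrite -E /= dotDr xb' => /eqP; rewrite -subr_eq0 addrAC subrr add0r.
Qed.

Lemma facet_sub F F' : facet P F -> facet P F' -> F `<=` F' -> F = F'.
Proof.
move=> FF FF' sFF'; have [a [b aF]] := facet_supports FF.
have [a' [b' aF']] := facet_supports FF'.
have [x Fx] := facet_nonempty FF.
apply: (supports_eq aF aF' Fx (sFF' _ Fx)).
apply: perp_sub_eq; [by case: aF | by case: aF' |].
apply/subvP => u; rewrite !mem_perp => /eqP ua.
have xb : dot a x = b by case: aF Fx => _ _ -> [].
have xb' : dot a' x = b' by case: aF' (sFF' _ Fx) => _ _ -> [].
have : affine_hull F (x + u).
  by rewrite (facet_hull FF aF) /= dotDr xb ua addr0.
have Fb' z : F z -> dot a' z = b' by move/sFF'; case: aF' => _ _ -> [].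
move=> /(affine_hull_plane Fb'); rewrite dotDr xb' => /eqP.
by rewrite -subr_eq0 addrAC subrr add0r.
Qed.

(** Normals of the same facet are proportional; comparing them on a point of [P]
    off the plane shows that the factor is positive. *)
Lemma outer_normal F a b a' b' d : facet P F -> supports a b F ->
  supports a' b' F -> 0 < dot a d -> 0 < dot a' d.
Proof.
move=> FF aF aF' ad; have aa' := facet_perp FF aF aF'.
have [v Fv] := facet_nonempty FF.
have [z Pz zb] : exists2 z, P z & dot a z != b.
  apply: contrapT => nz; case: aF => /eqP + _ _; apply.
  apply: (@P_flat0 _ b) => x Px; apply/eqP/negP => /negP xb.
  by apply: nz; exists x.
have [_ Pa FE] := aF; have [_ Pa' FE'] := aF'.
have [Pv vb] : P v /\ dot a v = b by move: Fv; rewrite FE.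
have [_ vb'] : P v /\ dot a' v = b' by move: Fv; rewrite FE'.
have zlt : dot a (z - v) < 0.
  by rewrite dotBr vb subr_lt0 lt_neqAle zb Pa.
have zlt' : dot a' (z - v) < 0.
  rewrite dotBr vb' subr_lt0 lt_neqAle Pa' // andbT.
  apply: contra zb => /eqP zb'.
  have : F z by rewrite FE'; split.
  by rewrite FE => -[_ ->].
pose k := dot a d / dot a (z - v).
have k0 : k < 0 by rewrite pmulr_rlt0 // invr_lt0.
have : d - k *: (z - v) \in perp a.
  by rewrite mem_perp dotBr dotZr /k divfK ?subrr // lt_eqF.
rewrite aa' mem_perp dotBr dotZr subr_eq0 => /eqP ->.
by rewrite nmulr_rgt0.
Qed.

Lemma exit_facet_normal v d : P v -> ~ feasible v d ->
  exists F, [/\ facet P F, F v & forall a b, supports a b F -> 0 < dot a d].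
Proof.
move=> Pv /(exit_facet Pv)[F [a [b [FF aF Fv ad]]]].
by exists F; split=> // a' b' aF'; exact: outer_normal aF aF' ad.
Qed.

Lemma facet_sub_P F x : facet P F -> F x -> P x.
Proof. by move=> /facet_supports[a [b [_ _ ->]]] []. Qed.

(** * The boundary is the union of the facets *)

Lemma closure_halfspace c b v : closure P v -> (forall x, P x -> dot c x <= b) ->
  dot c v <= b.
Proof.
move=> Pv Pb; rewrite leNgt; apply/negP => bv.
(* The sum bounds the functional by the sup norm; 1 keeps [M] positive. *)
pose M := 1 + \sum_i `|c 0 i|.
have M0 : 0 < M by rewrite ltr_pwDl // sumr_ge0.
pose r := (dot c v - b) / M.
have r0 : 0 < r by rewrite divr_gt0 // subr_gt0.
have [x [Px [_ vx]]] : P `&` ball v r !=set0.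
  by apply: Pv; exact: nbhsx_ballx.
have : dot c v - dot c x <= r * \sum_i `|c 0 i|.
  rewrite -dotBr /dot mulr_sumr; apply: ler_sum => i _.
  rewrite (le_trans (ler_norm _)) // normrM mulrC ler_wpM2r //.
  by have := vx 0 i; rewrite /ball /= !mxE => /ltW.
have := Pb x Px; have : r * M = dot c v - b by rewrite divfK // gt_eqF.
by rewrite /M; nra.
Qed.

(** A point outside [P] is separated from [P] by the lemma of Farkas for the cone
    over [P], placed at height one in one more dimension. *)
Lemma P_closed : closure P `<=` P.
Proof.
move=> v Pv; apply: contrapT => nPv.
pose C (p : V * R^o) := p = 0 \/ 0 < p.2 /\ P (p.2^-1 *: p.1).
pose br (c p : V * R^o) : R := dot c.1 p.1 + c.2 * p.2.
have [||||||||[c g] cs] := @farkas R (V * R^o)%type (V * R^o)%type br C _ _ _ _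
  _ _ [seq (x, 1) | x <- s] (v, 1).
- by move=> k [c g] [c' g'] [x t]; rewrite /br /= dotZDl -[k *: g]/(k * g); ring.
- by move=> k [c g] [x t] [x' t']; rewrite /br /= dotZDr -[k *: t]/(k * t); ring.
- move=> [x t] xt0; exists (x, t); rewrite /br /=.
  have [x0|/dot_gt0 x0] := eqVneq x 0; last by rewrite ltr_pwDl // -expr2 sqr_ge0.
  rewrite x0 dot0r add0r -expr2 lt_neqAle sqr_ge0 andbT eq_sym expf_eq0 /=.
  by apply: contra_neq xt0 => ->; rewrite x0.
- by left.
- move=> [x t] [y q] [[-> ->]|[/= t0 Pt]]; first by rewrite add0r.
  move=> [[-> ->]|[/= q0 Pq]]; first by rewrite addr0; right.
  right; rewrite /=; have tq : 0 < t + q by exact: addr_gt0.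
  split=> //.
  have k0 : 0 <= t / (t + q) by rewrite divr_ge0 ?ltW.
  have k1 : t / (t + q) <= 1 by rewrite ler_pdivrMr // mul1r lerDl ltW.
  have := P_convex Pt Pq k0 k1; congr (P _).
  by apply/rowP => i; rewrite !mxE; field; rewrite !gt_eqF.
- move=> k [x t]; rewrite le_eqVlt => /predU1P[<- _|k0].
    by left; rewrite scale0r.
  move=> [->|[/= t0 Pt]]; first by left; rewrite scaler0.
  right; split=> /=; first by rewrite -[k *: t]/(k * t) mulr_gt0.
  move: Pt; congr (P _); rewrite -[k *: t]/(k * t).
  by apply/rowP => i; rewrite !mxE; field; rewrite !gt_eqF.
- move=> _ /mapP[x xs ->]; right; split=> //=.
  by rewrite invr1 scale1r; exact: P_generator.
- move=> [[_ /eqP]|[_ /=]]; first by rewrite oner_eq0.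
  by rewrite invr1 scale1r.
rewrite /br /= mulr1 => vg.
have : dot c v <= - g.
  apply: closure_halfspace => //; apply: P_le => x xs.
  by have := cs (x, 1); rewrite /br /= mulr1 map_f // => /(_ isT); lra.
lra.
Qed.

Lemma facet_boundary F x : facet P F -> F x -> boundary P x.
Proof.
move=> /facet_supports[a [b [a0 Pa ->]]] [Px xb].
split; first exact: subset_closure.
rewrite /interior => /nbhs_ballP[r /= r0 Pr].
pose M := 1 + \sum_i `|a 0 i|.
have M0 : 0 < M by rewrite ltr_pwDl // sumr_ge0.
have k0 : 0 < r / M by rewrite divr_gt0.
have /Pa : P (x + (r / M) *: a).
  apply: Pr; split=> // i j; rewrite (ord1 i) /ball /= !mxE.
  rewrite opprD addrA subrr sub0r normrN normrM (gtr0_norm k0).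
  rewrite mulrAC ltr_pdivrMr // ltr_pM2l // /M.
  rewrite (bigD1 j) //=; have : 0 <= \sum_(i0 | i0 != j) `|a 0 i0| by exact: sumr_ge0.
  lra.
rewrite dotDr dotZr xb; have := mulr_gt0 k0 (dot_gt0 a0); lra.
Qed.

Lemma feasible_uniform v (ds : seq V) : P v ->
  (forall d, d \in ds -> feasible v d) ->
  exists2 r : R, 0 < r & forall d, d \in ds -> P (v + r *: d).
Proof.
move=> Pv; elim: ds => [|d ds IH] fd; first by exists 1.
have [|r r0 Pr] := IH; first by move=> e eds; apply: fd; rewrite inE eds orbT.
have [|q q0 Pq] := fd d; first by rewrite inE eqxx.
exists (Num.min r q); first by rewrite lt_min r0.
have m0 : 0 <= Num.min r q by rewrite le_min !ltW.
move=> e; rewrite inE => /predU1P[->|/Pr Pe].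
  by apply: feasible_le Pq _ _ => //; rewrite ge_min lexx orbT.
by apply: feasible_le Pe _ _ => //; rewrite ge_min lexx.
Qed.

Lemma boundary_sub_P x : boundary P x -> P x.
Proof. by move=> [/P_closed]. Qed.

(** At a point of [P] on no facet every direction is feasible.  A uniform step
    along the six axis directions then gives a ball inside [P]. *)
Lemma boundary_facet x : boundary P x -> exists2 F, facet P F & F x.
Proof.
move=> bx; have Px := boundary_sub_P bx; apply: contrapT => nF.
have fx d : feasible x d.
  apply: contrapT => /(exit_facet Px)[F [a [b [FF _ Fx _]]]].
  by apply: nF; exists F.
case: bx => _; apply; rewrite /interior; apply/nbhs_ballP.
pose ds := [seq axis R i | i <- enum 'I_3] ++ [seq - axis R i | i <- enum 'I_3].
have [r r0 Pr] := feasible_uniform Px (fun d (_ : d \in ds) => fx d).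
have Pt i t : `|t| <= r -> P (x + t *: axis R i).
  move=> tr; have [t0|t0] := leP 0 t.
    apply: (@feasible_le _ _ r) => //.
      by apply: Pr; rewrite mem_cat map_f // mem_enum.
    by rewrite -(ger0_norm t0).
  rewrite -[t]opprK scaleNr -scalerN; apply: (@feasible_le _ _ r) => //.
  - by apply: Pr; rewrite mem_cat (map_f (fun j => - axis R j)) ?orbT // mem_enum.
  - by rewrite oppr_ge0 ltW.
  - by rewrite -(ltr0_norm t0).
(* A point [y] of the ball is the mean of the three points of [P] obtained by
   moving [x] along one axis each, three times as far as [y] does. *)
exists (r / 3) => /=; first by rewrite divr_gt0.
move=> y [_ xy].
have Py i : P (x + (3 * (y 0 i - x 0 i)) *: axis R i).
  apply: Pt; have := xy 0 i; rewrite /ball /= distrC => h.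
  by rewrite normrM ger0_norm //; lra.
have h : (0 <= 2^-1 :> R) /\ (2^-1 <= 1 :> R) by lra.
have h' : (0 <= 3^-1 :> R) /\ (3^-1 <= 1 :> R) by lra.
have P12 := P_convex (Py 1) (Py 2%:R) h.1 h.2.
have := P_convex (Py 0) P12 h'.1 h'.2; congr (P _).
apply/rowP => i; rewrite !mxE !eqxx /=.
case: i => [[|[|[|//]]] lti]; set j := Ordinal lti.
- have -> : j = 0 by exact: val_inj.
  by rewrite /=; field.
- have -> : j = 1 by exact: val_inj.
  by rewrite /=; field.
- have -> : j = 2%:R by exact: val_inj.
  by rewrite /=; field.
Qed.

(** * Finitely many facets *)

(** A facet is spanned by the generators on it, so it is determined by a set of
    generators. *)
Lemma facets_finite : exists (T : finType) (G : T -> set V),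
  forall F, facet P F -> exists t, F = G t.
Proof.
exists ((size s).-tuple bool).
exists (fun m : (size s).-tuple bool => convex_hull [set` mask m s]).
move=> F /facet_supports[a [b [_ Pa ->]]].
exists [tuple of map (fun y => dot a y == b) (in_tuple s)].
rewrite /= -filter_mask; apply/seteqP; split=> x.
  rewrite P_hull => -[Px xb].
  have sb y : [set` s] y -> dot a y <= b by move=> ys; apply/Pa/P_generator.
  have := convex_hull_face sb Px xb; congr (convex_hull _ x).
  apply/seteqP; split=> y /=; rewrite mem_filter.
    by move=> [-> ->]; rewrite eqxx.
  by move=> /andP[/eqP -> ->].
apply: convex_hull_min => [y z t [Py yb] [Pz zb] t0 t1|y /=].
  by split; [exact: P_convex | rewrite !dotE yb zb; ring].
by rewrite mem_filter => /andP[/eqP yb ys]; split=> //; exact: P_generator.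
Qed.

(** The midpoint of two points of [P] lies on a facet only if both points do.  So
    one facet after the other is avoided by passing to the midpoint with a point
    of [F] outside it. *)
Lemma facet_private_point F : facet P F ->
  exists2 x, F x & forall F', facet P F' -> F' x -> F' = F.
Proof.
move=> FF; have [T [G FG]] := facets_finite.
suff [x Fx xG] : exists2 x, F x &
    forall t, t \in enum T -> facet P (G t) -> G t x -> G t = F.
  exists x => // F' FF' F'x; have [t E] := FG F' FF'.
  by rewrite E; apply: xG; rewrite ?mem_enum -?E.
elim: (enum T) => [|t ts [x Fx xG]].
  by have [x Fx] := facet_nonempty FF; exists x.
have [nGt|] := pselect (~ (facet P (G t)) \/ G t = F).
  exists x => // u; rewrite inE => /predU1P[-> Gt _|]; last exact: xG.
  by case: nGt.
move=> /not_orP[/contrapT Gt GtF].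
have [y Fy yG] : exists2 y, F y & ~ G t y.
  apply: contrapT => ny; apply: GtF; apply/esym/facet_sub => // y Fy.
  by apply: contrapT => yG; apply: ny; exists y.
have [Px Py] := (facet_sub_P FF Fx, facet_sub_P FF Fy).
pose m := 2^-1 *: x + (1 - 2^-1) *: y.
have mG F' : facet P F' -> F' m -> F' x /\ F' y.
  move=> /facet_supports[a [b [_ Pa ->]]] [_]; rewrite !dotE.
  by have := Pa x Px; have := Pa y Py; split; split=> //; lra.
exists m.
  have [a [b [_ Pa FE]]] := facet_supports FF.
  move: Fx Fy; rewrite FE => -[_ xb] [_ yb]; split; last first.
    by rewrite !dotE xb yb; ring.
  by apply: P_convex => //; lra.
move=> u; rewrite inE => /predU1P[-> _ /(mG _ Gt)[]//|uts Gu /(mG _ Gu)[]].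
by move=> Gux _; exact: xG.
Qed.

(** * Two facets of a simple polytope meet in an edge *)

Hypothesis P_simple : forall v, vertex P v ->
  ([set F | facet P F /\ F v] #= `I_3)%card.

Lemma cap_face F1 F2 a1 b1 a2 b2 : supports a1 b1 F1 -> supports a2 b2 F2 ->
  (forall x, P x -> dot (a1 + a2) x <= b1 + b2) /\
  F1 `&` F2 = [set x | P x /\ dot (a1 + a2) x = b1 + b2].
Proof.
move=> [_ Pa1 ->] [_ Pa2 ->]; split=> [x Px|].
  by rewrite dotDl lerD ?Pa1 ?Pa2.
apply/seteqP; split=> x; first by move=> [[Px E1] [_ E2]]; rewrite /= dotDl E1 E2.
move=> [Px]; rewrite dotDl => E; have := Pa1 x Px; have := Pa2 x Px.
by move=> h1 h2; do 2!split=> //; lra.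
Qed.

Lemma vertex_exposed c b p : (forall x, P x -> dot c x <= b) ->
  [set x | P x /\ dot c x = b] = [set p] -> vertex P p.
Proof.
move=> Pc Ep; split; first by exists c, b.
exists p, 0%VS; split; last by rewrite dimv0.
apply/seteqP; split=> y /=.
  apply: (@affine_hull_min _ _ [set z | z - p \in 0%VS]); last first.
    by move=> z /= ->; rewrite subrr mem0v.
  move=> z w /= zp wp t; move: zp wp; rewrite !memv0 !subr_eq0 => /eqP -> /eqP ->.
  by rewrite -scalerDl subrK scale1r.
by rewrite memv0 subr_eq0 => /eqP ->; exact: sub_affine_hull.
Qed.

(** Otherwise [p] is a vertex, and the line common to the planes of [F1] and [F2]
    leaves [P] at [p] in both directions.  The facets across which it does so
    differ from [F1] and [F2], which are parallel to the line, and from each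
    other, which makes four facets at a vertex. *)
Lemma facets_meet_twice F1 F2 p : facet P F1 -> facet P F2 -> F1 <> F2 ->
  F1 p -> F2 p -> exists q, [/\ q != p, F1 q & F2 q].
Proof.
move=> FF1 FF2 F12 F1p F2p; apply: contrapT => nq.
have [a1 [b1 aF1]] := facet_supports FF1.
have [a2 [b2 aF2]] := facet_supports FF2.
have [Pc Ec] := cap_face aF1 aF2.
have Vp : vertex P p.
  apply: vertex_exposed Pc _; rewrite -Ec; apply/seteqP; split=> x /=; last first.
    by move=> ->.
  move=> [F1x F2x]; apply/eqP/negP => /negP xp; apply: nq; by exists x.
have Pp := facet_sub_P FF1 F1p.
have [d d0 [a1d a2d]] := common_perp a1 a2.
have nf e : e != 0 -> dot a1 e = 0 -> dot a2 e = 0 -> ~ feasible p e.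
  move=> e0 a1e a2e [r r0 Pr]; apply: nq; exists (p + r *: e).
  have [[_ _ F1E] [_ _ F2E]] := (aF1, aF2).
  move: F1p F2p; rewrite F1E F2E => -[_ p1] [_ p2].
  split=> /=; rewrite ?dotDr ?dotZr ?a1e ?a2e ?mulr0 ?addr0 //.
  by rewrite -subr_eq0 addrAC subrr add0r scaler_eq0 negb_or gt_eqF.
have [F3 [FF3 F3p a3d]] := exit_facet_normal Pp (nf d d0 a1d a2d).
have nd : ~ feasible p (- d).
  by apply: nf; rewrite ?oppr_eq0 // dotNr ?a1d ?a2d oppr0.
have [F4 [FF4 F4p a4d]] := exit_facet_normal Pp nd.
have [a3 [b3 aF3]] := facet_supports FF3.
have le3 : ([set F | facet P F /\ F p] #<= `I_3)%card.
  by have := P_simple Vp; rewrite card_eq_le => /andP[].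
apply: (card_le3_four le3 (x := F1) (y := F2) (z := F3) (w := F4)) => //.
- by move=> E; have := a3d a1 b1; rewrite -E a1d ltxx => /(_ aF1).
- by move=> E; have := a4d a1 b1; rewrite -E dotNr a1d oppr0 ltxx => /(_ aF1).
- by move=> E; have := a3d a2 b2; rewrite -E a2d ltxx => /(_ aF2).
- by move=> E; have := a4d a2 b2; rewrite -E dotNr a2d oppr0 ltxx => /(_ aF2).
move=> E; have := a3d a3 b3 aF3; have := a4d a3 b3; rewrite -E => /(_ aF3).
rewrite dotNr; lra.
Qed.

(** The direction of the common edge spans the intersection of the direction
    spaces of the two planes, so an axis is parallel to the edge when it is
    parallel to both planes, and only one axis can be. *)
Lemma facets_meet_edge F1 F2 p : facet P F1 -> facet P F2 -> F1 <> F2 ->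
  F1 p -> F2 p ->
  [/\ edge P (F1 `&` F2), marks (F1 `&` F2) = (marks F1 :&: marks F2)%SET &
      (#|marks F1 :&: marks F2| <= 1)%N].
Proof.
move=> FF1 FF2 F12 F1p F2p.
have [q [qp F1q F2q]] := facets_meet_twice FF1 FF2 F12 F1p F2p.
have [a1 [b1 aF1]] := facet_supports FF1.
have [a2 [b2 aF2]] := facet_supports FF2.
have [Pc Ec] := cap_face aF1 aF2.
have a12 : perp a1 != perp a2.
  by apply/eqP => /(supports_eq aF1 aF2 F1p F2p).
have F1b z : F1 z -> dot a1 z = b1 by case: aF1 => _ _ -> [].
have F2b z : F2 z -> dot a2 z = b2 by case: aF2 => _ _ -> [].
have dim1 : \dim (perp a1 :&: perp a2) = 1%N.
  by apply: dim_perp_cap a12; [case: aF1 | case: aF2].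
have lineE : (perp a1 :&: perp a2)%VS = <[q - p]>%VS.
  apply/eqP; rewrite eq_sym eqEdim dim1 dim_vline subr_eq0 qp /= andbT.
  by rewrite -memvE memv_cap !mem_perp !dotBr !F1b // !F2b // !subrr eqxx.
have hullE : affine_hull (F1 `&` F2) = [set y | y - p \in (perp a1 :&: perp a2)%VS].
  apply/seteqP; split=> y /=.
    move=> Ey; rewrite memv_cap !mem_perp !dotBr !subr_eq0 (F1b p) // (F2b p) //.
    rewrite (@affine_hull_plane _ (F1 `&` F2) a1 b1) ?eqxx //=; last first.
      by move=> x [/F1b].
    by rewrite (@affine_hull_plane _ (F1 `&` F2) a2 b2) // => x [_ /F2b].
  rewrite lineE => /vlineP[t /eqP]; rewrite subr_eq addrC => /eqP ->.
  apply: (affine_line t (@affine_hull_affine _ (F1 `&` F2)));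
    by rewrite ?subrKC; exact: sub_affine_hull.
have mE i : (i \in marks (F1 `&` F2)) =
    (axis R i \in (perp a1 :&: perp a2)%VS).
  rewrite inE; apply/asboolP/idP; rewrite hullE.
    move=> /(_ p _ 1) /=; rewrite subrr mem0v scale1r addrC addKr; exact.
  by move=> ai x /= xE t; rewrite addrAC memvD // memvZ.
have mI : marks (F1 `&` F2) = (marks F1 :&: marks F2)%SET.
  apply/setP => i; rewrite mE finset.in_setI (facet_marks i FF1 aF1).
  by rewrite (facet_marks i FF2 aF2) memv_cap !mem_perp !dot_axis.
split=> //.
  split; first by exists (a1 + a2), (b1 + b2).
  exact: affine_dimE hullE dim1.
apply/card_le1_eqP => i j; rewrite -mI !mE lineE => /vlineP[k ik] /vlineP[l jl].
apply/eqP/negP => /negP ij.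
have k0 : k != 0.
  by apply: contra_neq (axis_neq0 R i) => k0; rewrite ik k0 scale0r.
have : axis R j = (l / k) *: axis R i.
  by rewrite ik scalerA divfK.
move=> /rowP/(_ j); rewrite !mxE !eqxx /= (negPf ij) mulr0.
by move/eqP; rewrite oner_eq0.
Qed.

(** Since the marks of the common edge are the common marks of the two facets,
    only nested sets of marks can prevent adjacency. *)
Lemma facets_adj F1 F2 p : facet P F1 -> facet P F2 -> F1 p -> F2 p ->
  ~~ (marks F1 \subset marks F2) -> ~~ (marks F2 \subset marks F1) ->
  face_adj P F1 F2.
Proof.
move=> FF1 FF2 F1p F2p m12 m21.
have F12 : F1 <> F2 by move=> E; rewrite E subxx in m12.
have [EE mE _] := facets_meet_edge FF1 FF2 F12 F1p F2p.
split=> //; exists (F1 `&` F2); split=> //; rewrite mE.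
- by apply: contra m12 => /eqP/finset.setIidPl.
- by apply: contra m21 => /eqP/finset.setIidPr.
Qed.

Lemma marks_le2 F : facet P F -> (#|marks F| <= 2)%N.
Proof.
move=> FF; have [a [b aF]] := facet_supports FF.
have [k ak] : exists k, a 0 k != 0.
  apply: contrapT => nk; case: aF => /eqP + _ _; apply.
  apply/rowP => k; rewrite mxE; apply/eqP/negP => /negP ak; by apply: nk; exists k.
suff : (#|marks F| < #|'I_3|)%N by rewrite card_ord ltnS.
apply: proper_card; apply/properP; split; first exact/fintype.subsetP.
by exists k; rewrite // (facet_marks k FF aF).
Qed.

(** As a face is spanned by its generators, the one that is farthest in the
    direction [u] is an end of the face. With [a = 0] this applies to [P]
    itself. *)
Lemma face_end a b u : (forall x, P x -> dot a x <= b) ->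
  (exists x, P x /\ dot a x = b) -> dot a u = 0 -> u != 0 ->
  exists v, [/\ P v, dot a v = b & ~ feasible v u].
Proof.
move=> Pa [x [Px xb]] au u0.
have sb y : [set` s] y -> dot a y <= b by move=> ys; apply/Pa/P_generator.
have gen y : P y -> dot a y = b ->
    convex_hull [set y | [set` s] y /\ dot a y = b] y.
  by rewrite P_hull; exact: convex_hull_face.
have [y0 [y0s y0b]] : exists y, y \in s /\ dot a y = b.
  apply: contrapT => ny; have := gen x Px xb.
  by apply: (@convex_hull_min _ _ set0) => // y yb; apply: ny; exists y.
have [v [vs /eqP vb vmax]] := @seq_argmin R _ s (fun y => dot a y == b)
  (fun y => - dot u y) y0 y0s (introT eqP y0b).
exists v; split; [exact: P_generator | by [] |] => -[r r0 Pr].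
have := gen _ Pr; rewrite dotDr dotZr au mulr0 addr0 => /(_ vb).
have umax y : [set y | [set` s] y /\ dot a y = b] y -> dot u y <= dot u v.
  by move=> [ys yb]; rewrite -lerN2; apply: vmax => //; apply/eqP.
move=> /(convex_hull_le umax); rewrite dotDr dotZr.
have := mulr_gt0 r0 (dot_gt0 u0); lra.
Qed.

Lemma facet_exists : exists F, facet P F.
Proof.
have [x Px] : exists x, P x.
  apply: contrapT => nP; have : affine_hull P 0 by rewrite hull_full.
  by apply: (@affine_hull_min _ _ set0) => // y Py; apply: nP; exists y.
have [||||v [Pv _ nv]] := @face_end 0 0 (axis R 0).
- by move=> y _; rewrite dotC dot0r.
- by exists x; rewrite dotC dot0r.
- by rewrite dotC dot0r.
- exact: axis_neq0.
have [F [FF _ _]] := exit_facet_normal Pv nv; by exists F.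
Qed.

(** * Orthogonal paths in the boundary *)

Notation linked := (clos_refl_trans (set V) (face_adj P)).

Lemma linked_sym F1 F2 : linked F1 F2 -> linked F2 F1.
Proof.
elim=> [F F' [FF FF' nF [E [EE EF EF' m m']]]|F|F F' F'' _ h _ h'].
- by apply: rt_step; split=> // [/esym//|]; exists E.
- exact: rt_refl.
- exact: rt_trans h' h.
Qed.

(** A facet containing the midpoint contains the segment: a linear functional
    that reaches its maximum over a segment at the midpoint is constant on it. *)
Lemma axis_segment_facet x y i t : y - x = t *: axis R i -> x != y ->
  segment x y `<=` boundary P ->
  exists F, [/\ facet P F, F x, F y & i \in marks F].
Proof.
move=> xyt xy sxy.
have seg k : 0 <= k -> k <= 1 -> boundary P ((1 - k) *: x + k *: y).
  by move=> k0 k1; apply: sxy; exists k => //=; rewrite in_itv /= k0.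
have [F FF Fm] : exists2 F, facet P F & F ((1 - 2^-1) *: x + 2^-1 *: y).
  by apply: boundary_facet; apply: seg; lra.
have Px : P x.
  by have /boundary_sub_P := seg 0 (lexx _) ler01; rewrite subr0 scale1r scale0r addr0.
have Py : P y.
  by have /boundary_sub_P := seg 1 ler01 (lexx _); rewrite subrr scale1r scale0r add0r.
have [a [b aF]] := facet_supports FF; have [_ Pa FE] := aF.
have Em : dot a ((1 - 2^-1) *: x + 2^-1 *: y) = b by move: Fm; rewrite FE => -[].
have [xb yb] : dot a x = b /\ dot a y = b.
  by move: Em (Pa x Px) (Pa y Py); rewrite !dotE => *; split; lra.
have [Fx Fy] : F x /\ F y by rewrite FE.
exists F; split=> //; rewrite (facet_marks i FF aF).
have : dot a (y - x) = 0 by rewrite dotBr xb yb subrr.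
rewrite xyt dotZr dot_axis => /eqP; rewrite mulf_eq0 => /orP[/eqP t0|//].
by move: xyt xy; rewrite t0 scale0r => /eqP; rewrite subr_eq0 eq_sym => ->.
Qed.

Lemma facet_along_axis F i x t y : facet P F -> i \in marks F -> F x -> P y ->
  y = x + t *: axis R i -> F y.
Proof.
move=> FF iF Fx Py yE; have [a [b aF]] := facet_supports FF.
move: iF; rewrite (facet_marks i FF aF) => /eqP ai.
move: aF Fx => [_ _ ->] [_ xb]; split=> //.
by rewrite yE dotDr dotZr dot_axis ai mulr0 addr0.
Qed.

Hypothesis bd_conn : orthogonally_connected (boundary P).

Definition bd_path x l := orthogonal_path_in (boundary P) x l.

Lemma bd_path_cons x z l : bd_path x (z :: l) ->
  exists i t F, [/\ z = x + t *: axis R i, facet P F, F x, F z &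
     i \in marks F] /\ bd_path z l.
Proof.
rewrite /bd_path /orthogonal_path_in /= => /andP[/asboolP[[xz [i [t E]]] sxz] pl].
have /eqP xz' := xz.
have [F [FF Fx Fz iF]] := axis_segment_facet E xz' sxz.
by exists i, t, F; split=> //; split=> //; rewrite -E subrKC.
Qed.

Lemma facet_two_points F x : facet P F -> exists2 y, F y & y != x.
Proof.
move=> FF; apply: contrapT => ny; have [a [b aF]] := facet_supports FF.
have Fx y : F y -> y = x.
  by move=> Fy; apply/eqP/negP => /negP yx; apply: ny; exists y.
have [z Fz] := facet_nonempty FF; have zx := Fx z Fz.
have [e e0 [ae _]] := common_perp a a.
have : affine_hull F (z + e).
  by rewrite (facet_hull FF aF) /= dotDr ae addr0; case: aF Fz => _ _ -> [].
have hull_z : affine_hull F `<=` [set z].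
  apply: affine_hull_min => [y y' /= -> -> t|y /Fx ->]; last by rewrite zx.
  by rewrite -scalerDl subrK scale1r.
move=> /hull_z /= /eqP; rewrite -subr_eq0 addrAC subrr add0r.
exact/negP.
Qed.

Lemma marks_nonempty F : facet P F -> exists i, i \in marks F.
Proof.
move=> FF; have [x Fx xF] := facet_private_point FF.
have [y Fy yx] := facet_two_points x FF.
have xy : x <> y by move=> E; rewrite E eqxx in yx.
have [[|z l] pl lE] :=
  bd_conn (facet_boundary FF Fx) (facet_boundary FF Fy) xy; first by case: xy.
have [i [t [G [[_ GG Gx _ iG] _]]]] := bd_path_cons pl.
by exists i; rewrite -(xF G GG Gx).
Qed.

(** Following the common edge of [F1] and [F2] along the axis [i], one reaches a
    point where [P] is left across a facet [F3].  It is not parallel to the axis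
    [i], so its marks are disjoint from those of [F1] and [F2]. *)
Lemma parallel_strips_linked F1 F2 p i : facet P F1 -> facet P F2 ->
  F1 p -> F2 p -> marks F1 = [set i]%SET -> marks F2 = [set i]%SET ->
  linked F1 F2.
Proof.
move=> FF1 FF2 F1p F2p m1 m2.
have [a1 [b1 aF1]] := facet_supports FF1.
have [a2 [b2 aF2]] := facet_supports FF2.
have [Pc Ec] := cap_face aF1 aF2.
have a1i : a1 0 i = 0.
  by apply/eqP; rewrite -(facet_marks i FF1 aF1) m1 finset.in_set1.
have a2i : a2 0 i = 0.
  by apply/eqP; rewrite -(facet_marks i FF2 aF2) m2 finset.in_set1.
have [||v [Pv vE nv]] := @face_end _ _ (axis R i) Pc _ _ (axis_neq0 R i).
- by exists p; have : (F1 `&` F2) p by []; rewrite Ec.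
- by rewrite dotDl !dot_axis a1i a2i addr0.
have [F1v F2v] : (F1 `&` F2) v by rewrite Ec.
have [F3 [FF3 F3v a3i]] := exit_facet_normal Pv nv.
have i3 : i \notin marks F3.
  have [a3 [b3 aF3]] := facet_supports FF3.
  by rewrite (facet_marks i FF3 aF3) -dot_axis gt_eqF // (a3i a3 b3).
have [j j3] := marks_nonempty FF3.
have s13 : ~~ ([set i]%SET \subset marks F3) by rewrite finset.sub1set.
have s31 : ~~ (marks F3 \subset [set i]%SET).
  apply/negP => /fintype.subsetP/(_ j j3); rewrite finset.in_set1 => /eqP ji.
  by rewrite -ji j3 in i3.
by apply: (rt_trans _ _ _ F3); apply: rt_step; apply: (facets_adj (p := v));
  rewrite ?m1 ?m2.
Qed.

(** A segment of the boundary with end [q] and direction [i] lies in all facets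
    through [q] that are marked by [i].  When two such facets have different
    nested sets of marks, a path inside their common edge can turn only into the
    one with more marks; this is why a segment is attributed to a facet with as
    many marks as possible. *)
Definition owner F q i := [/\ facet P F, F q, i \in marks F &
  forall F', facet P F' -> F' q -> i \in marks F' -> (#|marks F'| <= #|marks F|)%N].

Lemma owner_exists F q i : facet P F -> F q -> i \in marks F ->
  exists G, owner G q i.
Proof.
move=> FF Fq iF.
have [[G [GG Gq iG G2]]|nG] := pselect (exists G, [/\ facet P G, G q,
    i \in marks G & (1 < #|marks G|)%N]).
  exists G; split=> // F' FF' _ _; exact: leq_trans (marks_le2 FF') G2.
exists F; split=> // F' FF' F'q iF'.
have /leq_trans : (#|marks F'| <= 1)%N.
  by rewrite leqNgt; apply/negP => h; apply: nG; exists F'.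
by apply; apply/card_gt0P; exists i.
Qed.

Lemma owner_along_axis F x y i t : owner F x i -> P x -> P y ->
  y = x + t *: axis R i -> owner F y i.
Proof.
move=> [FF Fx iF Fmax] Px Py yE.
split=> // [|F' FF' F'y iF']; first exact: facet_along_axis FF iF Fx Py yE.
apply: Fmax => //; apply: (facet_along_axis (t := - t) FF' iF' F'y Px).
by rewrite yE scaleNr addrK.
Qed.

(** The larger set of marks also contains [i], so the maximality of the owner [F]
    makes the two sets equal; being the marks of the common edge, they form a
    singleton. *)
Lemma owner_nested_linked F F' q i j : owner F q i -> owner F' q j ->
  marks F \subset marks F' -> linked F F'.
Proof.
move=> [FF Fq iF Fmax] [FF' F'q jF' _] sFF'.
have [->|nFF'] := pselect (F = F'); first exact: rt_refl.
have iF' : i \in marks F' by exact: (fintype.subsetP sFF').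
have [_ _] := facets_meet_edge FF FF' nFF' Fq F'q.
rewrite (finset.setIidPl sFF') => m1.
have mF : marks F = [set i]%SET.
  apply/eqP; rewrite eq_sym finset.eqEcard finset.sub1set iF.
  by rewrite finset.cards1.
have mF' : marks F' = [set i]%SET.
  rewrite -mF; apply/esym/eqP; rewrite finset.eqEcard sFF'; exact: Fmax.
exact: parallel_strips_linked Fq F'q mF mF'.
Qed.

Lemma owners_linked F F' q i j : owner F q i -> owner F' q j -> linked F F'.
Proof.
move=> oF oF'; have [s12|s12] := boolP (marks F \subset marks F').
  exact: owner_nested_linked oF oF' s12.
have [s21|s21] := boolP (marks F' \subset marks F).
  apply: linked_sym; exact: owner_nested_linked oF' oF s21.
case: oF oF' => [FF Fq _ _] [FF' F'q _ _]; apply: rt_step.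
exact: facets_adj Fq F'q s12 s21.
Qed.

Lemma path_linked l x F i : bd_path x l -> owner F x i ->
  exists G j, owner G (last x l) j /\ linked F G.
Proof.
elim: l x F i => [|z l IH] x F i.
  by move=> _ oF; exists F, i; split=> //; exact: rt_refl.
move=> /bd_path_cons[j [t [F' [[zE FF' F'x F'z jF'] pl]]]] oF.
have [H oH] := owner_exists FF' F'x jF'.
have oHz : owner H z j.
  by apply: owner_along_axis oH _ _ zE; exact: facet_sub_P FF' _.
have [G [k [oG HG]]] := IH z H j pl oHz.
by exists G, k; split=> //; apply: rt_trans HG; exact: owners_linked oF oH.
Qed.

Lemma boundary_conn_face_graph : face_graph_connected P.
Proof.
move=> F F' FF FF'; have [x Fx xF] := facet_private_point FF.
have [y F'y yF'] := facet_private_point FF'.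
have [xy|xy] := pselect (x = y).
  by rewrite (yF' F FF) -?xy //; exact: rt_refl.
have [l pl lE] := bd_conn (facet_boundary FF Fx) (facet_boundary FF' F'y) xy.
have [i iF] := marks_nonempty FF.
have oF : owner F x i by split=> // H HH Hx _; rewrite (xF H HH Hx).
have [G [j [oG FG]]] := path_linked pl oF.
by case: oG FG => GG Gl _ _; rewrite lE in Gl; rewrite (yF' G GG Gl).
Qed.

(** * Some facet is parallel to two axes *)

Section OneMark.
Hypothesis one_mark : forall F, facet P F -> #|marks F| = 1%N.
Variables (T : finType) (G : T -> set V) (n : T -> V) (h : T -> R).
Hypothesis facetG : forall F, facet P F -> exists t, F = G t.
Hypothesis facetn : forall t, facet P (G t) -> supports (n t) (h t) (G t).

(** The point where the line through [x] parallel to the axis [ct.1] meets the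
    plane of the facet [G ct.2], provided that they are transversal. *)
Definition turn x (ct : 'I_3 * T) :=
  x + ((h ct.2 - dot (n ct.2) x) / n ct.2 0 ct.1) *: axis R ct.1.

Lemma one_markE F i j : facet P F -> i \in marks F -> (j \in marks F) = (j == i).
Proof.
move=> FF iF; have /eqP/cards1P[k mk] := one_mark FF.
by move: iF; rewrite mk !finset.in_set1 => /eqP ->.
Qed.

(** The path keeps running on the line through the last turning point [tau]
    parallel to its axis.  It leaves this line only for a facet with another
    mark, hence transversal to the line.  So the words [c] of pairs of an axis
    and a facet code all possible turning points. *)
Lemma path_turns p x l F i tau (k : R) (c : seq ('I_3 * T)) : bd_path x l ->
  facet P F -> F x -> i \in marks F -> tau = foldl turn p c ->
  x = tau + k *: axis R i ->
  exists F' i' (c' : seq ('I_3 * T)) (k' : R), [/\ facet P F', F' (last x l),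
    i' \in marks F' & last x l = foldl turn p c' + k' *: axis R i'].
Proof.
elim: l x F i tau k c => [|z l IH] x F i tau k c.
  by move=> _ FF Fx iF -> xE; exists F, i, c, k.
move=> /bd_path_cons[j [t [F' [[zE FF' F'x F'z jF'] pl]]]] FF Fx iF tE xE.
have [ji|ji] := eqVneq j i.
  apply: (IH z F' j tau (k + t) c) => //.
  by rewrite zE xE ji scalerDl addrA.
have [u uE] := facetG FF'; have FG := FF'; rewrite uE in FG.
have nF := facetn FG; apply: (IH z F' j x t (rcons c (i, u))) => //.
rewrite foldl_rcons -tE xE /turn /=; congr (_ + _ *: _).
have ni : n u 0 i != 0.
  rewrite -(facet_marks i FG nF) -uE (one_markE _ FF' jF').
  by rewrite eq_sym.
have : dot (n u) x = h u by move: F'x; rewrite uE; case: nF => _ _ -> [].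
rewrite xE dotDr dotZr dot_axis => <-; field; exact: ni.
Qed.

(** The points [x + k *: d] lie in the relative interior of [F] on a segment
    orthogonal to the mark [i] of [F].  A path reaching one of them from [x]
    arrives in the direction [i], so [k] is a function of its last turning point;
    but there are only countably many turning points. *)
Lemma one_mark_absurd : False.
Proof.
have [F FF] := facet_exists; have [x Fx xF] := facet_private_point FF.
have [i iF] := marks_nonempty FF.
have [a [b aF]] := facet_supports FF; have [_ Pa FE] := aF.
have [d d0 [ad id]] := common_perp a (axis R i).
have Px := facet_sub_P FF Fx.
have [r r0 Pr] : feasible x d.
  apply: contrapT => /(exit_facet_normal Px)[F' [FF' F'x]].
  by move=> /(_ a b); rewrite (xF F') // => /(_ aF); rewrite ad ltxx.
have xb : dot a x = b by move: Fx; rewrite FE => -[].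
have only k F' : 0 <= k -> k < r -> facet P F' -> F' (x + k *: d) -> F' = F.
  move=> k0 kr FF' F'k; apply: xF => //.
  have [a' [b' [_ Pa' FE']]] := facet_supports FF'.
  move: F'k; rewrite FE' => -[_]; have := Pa' _ Px; have := Pa' _ Pr.
  rewrite !dotDr !dotZr => h1 h2 h3; split=> //; nra.
pose D : set R := [set k | 0 < k < r].
pose f (c : seq ('I_3 * T)) := (dot d (foldl turn x c) - dot d x) / dot d d.
have Df : D `<=` range f.
  move=> k /andP[k0 kr].
  have Fk : F (x + k *: d).
    rewrite FE; split; last by rewrite dotDr dotZr ad mulr0 addr0.
    exact: feasible_le Pr (ltW k0) (ltW kr).
  have xk : x <> x + k *: d.
    move=> /eqP; rewrite -subr_eq0 opprD addrA subrr sub0r oppr_eq0 scaler_eq0.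
    by rewrite (negPf d0) gt_eqF.
  have [l pl lE] := bd_conn (facet_boundary FF Fx) (facet_boundary FF Fk) xk.
  have x0 : x = x + 0 *: axis R i by rewrite scale0r addr0.
  have [F' [j [c [k' [FF' F'l jF' E]]]]] :=
    path_turns (c := [::]) pl FF Fx iF (erefl x) x0.
  rewrite lE in F'l E.
  have F'F := only k F' (ltW k0) kr FF' F'l; rewrite F'F in jF'.
  move: jF'; rewrite (one_markE _ FF iF) => /eqP ji.
  exists c => //; rewrite /f.
  have : dot d (x + k *: d) = dot d (foldl turn x c).
    by rewrite E dotDr dotZr ji (dotC d (axis R i)) id mulr0 addr0.
  have := dot_gt0 d0; rewrite dotDr dotZr => dd <-.
  by rewrite addrAC subrr add0r mulfK // gt_eqF.
have cD : countable D.
  apply: sub_countable (subset_card_le Df) _.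
  exact: sub_countable (card_image_le _ _) (countableP _).
have := countable_lebesgue_measure0 cD; rewrite /D -set_itvoo.
rewrite lebesgue_measure_itv /= lte_fin r0 => /eqP.
by rewrite sube0 eqe gt_eqF.
Qed.

End OneMark.

Lemma two_marks : exists2 F, facet P F & #|marks F| = 2%N.
Proof.
apply: contrapT => n2.
have one F : facet P F -> #|marks F| = 1%N.
  move=> FF; have [i iF] := marks_nonempty FF; apply/eqP.
  have : (0 < #|marks F|)%N by apply/card_gt0P; exists i.
  have : #|marks F| <> 2%N by move=> h; apply: n2; exists F.
  by have := marks_le2 FF; lia.
have [T [G facetG]] := facets_finite.
have /choice[nh facetn] (t : T) : exists nh : V * R,
    facet P (G t) -> supports nh.1 nh.2 (G t).
  have [/facet_supports[a [b aF]]|nF] := pselect (facet P (G t)).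
    by exists (a, b).
  by exists (0, 0).
exact: (one_mark_absurd (h := fun t => (nh t).2) one facetG facetn).
Qed.

Lemma boundary_conn_rich : rich P.
Proof.
split=> [F FF|]; last exact: two_marks.
by have [i iF] := marks_nonempty FF; apply/finset.set0Pn; exists i.
Qed.

End Polytope.

Theorem theorem3p1 (R : realType) (P : set 'rV[R]_3)
    (P_simple : simple_polytope P) (P_dim : affine_dim P 3%N)
    (bdP_conn : orthogonally_connected (boundary P)) :
  rich P /\ face_graph_connected P.
Proof.
have [[S /finite_seqP[s ->] P_hull] vP] := P_simple.
by split; [exact: boundary_conn_rich P_hull P_dim bdP_conn |
  exact: boundary_conn_face_graph P_hull P_dim vP bdP_conn].
Qed.
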